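(* Let $G=(V,E)$ be a finite connected graph with $N$ vertices and assume that $1/2<\epsilon<1$. Then $\mu_\epsilon(G)=N$ if and only if the graph $G$ is bipartite.
   Context: Graphs are simple and undirected. For a finite graph $G=(V,E)$ and a confidence threshold $\epsilon\in[0,1]$, an absorbing state (static configuration) is a map $\eta:V\to[0,1]$ such that for each edge $(x,y)\in E$ one has $|\eta(x)-\eta(y)|>\epsilon$ or $\eta(x)=\eta(y)$. The $\epsilon$-opinion index $\mu_\epsilon(G)$ is the maximum, over all absorbing states $\eta$, of the number of distinct opinions $\operatorname{card}\{\eta(x):x\in V\}$. *)

(* Defs.v *)
From HB Require Import structures.
From mathcomp Require Import all_boot all_order all_algebra.
From mathcomp Require Import boolp reals.

Set Implicit Arguments.
Unset Strict Implicit.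
Unset Printing Implicit Defensive.

Import Order.TTheory GRing.Theory Num.Theory.
Local Open Scope ring_scope.

Definition simple_graph (V : finType) (e : rel V) : Prop :=
  symmetric e /\ irreflexive e.

(* The graph with no vertices is not connected. *)
Definition connected_graph (V : finType) (e : rel V) : Prop :=
  (0 < #|V|)%N /\ forall x y : V, connect e x y.

(* A and its complement are the two parts, possibly empty. *)
Definition bipartite (V : finType) (e : rel V) : Prop :=
  exists A : {set V}, forall x y : V, e x y -> (x \in A) != (y \in A).

Definition absorbing (R : realType) (V : finType) (e : rel V) (eps : R)
    (eta : V -> R) : Prop :=
  (forall x, 0 <= eta x <= 1) /\
  (forall x y, e x y -> `|eta x - eta y| > eps \/ eta x = eta y).

Definition num_opinions (R : realType) (V : finType) (eta : V -> R) : nat :=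
  size (undup (codom eta)).

(* There are infinitely many states eta, so the maximum is taken over the
   values k that num_opinions reaches, all at most #|V|;
   opinion_index_attained and opinion_index_ub show that it is the maximum
   over all absorbing states. *)
Definition opinion_index (R : realType) (V : finType) (e : rel V) (eps : R)
    : nat :=
  (\max_(k < #|V|.+1 |
      `[< exists eta : V -> R, absorbing e eps eta /\ num_opinions eta = k >])
    k)%N.

Lemma num_opinions_le (R : realType) (V : finType) (eta : V -> R) :
  (num_opinions eta <= #|V|)%N.
Proof. by rewrite (leq_trans (size_undup _))// size_codom. Qed.

Lemma opinion_index_ub (R : realType) (V : finType) (e : rel V) (eps : R)
    (eta : V -> R) :
  absorbing e eps eta -> (num_opinions eta <= opinion_index e eps)%N.
Proof.
move=> eta_abs; have lt_k : (num_opinions eta < #|V|.+1)%N.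
  by rewrite ltnS num_opinions_le.
rewrite /opinion_index (bigD1 (Ordinal lt_k)) /= ?leq_maxl//.
by apply/asboolP; exists eta.
Qed.

Lemma opinion_index_attained (R : realType) (V : finType) (e : rel V)
    (eps : R) :
  exists eta : V -> R,
    absorbing e eps eta /\ num_opinions eta = opinion_index e eps.
Proof.
have abs0 : absorbing e eps (fun=> 0).
  by split=> [x|x y _]; [rewrite lexx ler01 | right].
have lt_k : (num_opinions (fun _ : V => 0%R : R) < #|V|.+1)%N.
  by rewrite ltnS (@num_opinions_le R V).
pose P (k : 'I_#|V|.+1) :=
  `[< exists eta : V -> R, absorbing e eps eta /\ num_opinions eta = k >].
have P0 : P (Ordinal lt_k) by apply/asboolP; exists (fun=> 0).
rewrite /opinion_index (bigop.bigmax_eq_arg (Ordinal lt_k)) //.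
by case: arg_maxnP => // k /asboolP.
Qed.

(* Main.v *)
Require Import Defs.
From HB Require Import structures.
From mathcomp Require Import all_boot all_order all_algebra.
From mathcomp Require Import boolp reals.
From mathcomp Require Import lra.

Set Implicit Arguments.
Unset Strict Implicit.
Unset Printing Implicit Defensive.

Import Order.TTheory GRing.Theory Num.Theory.
Local Open Scope ring_scope.

(** The index reaches [#|V|] exactly when some absorbing state is injective
    ([opinion_index_card]), so that neighbours always disagree by more than
    [eps].

    When [eps] is at least [1/2], neighbours in such a state cannot lie on the
    same side of [1/2], because each half of the unit interval has length
    [1/2]: the vertices with opinion below [1/2] form one part of a bipartition
    ([bipartite_of_inj_absorbing]).

    Conversely, given a bipartition and [eps < 1], put the opinions of one part
    at distinct points close to [0] and those of the other at distinct points
    close to [1].  If each is closer than [(1 - eps) / 2] to its endpoint,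
    then opinions across the two parts, hence across every edge, differ by more
    than [eps] ([inj_absorbing_of_bipartite]). *)

Lemma num_opinions_card (R : realType) (V : finType) (eta : V -> R) :
  num_opinions eta = #|V| <-> injective eta.
Proof.
split=> [eq_card|eta_inj].
  apply/injectiveP; rewrite /injectiveb /dinjectiveb.
  have := ltn_size_undup (codom eta).
  by rewrite -/(num_opinions eta) eq_card size_codom ltnn => /esym/negbFE.
by rewrite /num_opinions undup_id ?size_codom//; exact/injectiveP.
Qed.

Lemma opinion_index_card (R : realType) (V : finType) (e : rel V) (eps : R) :
  opinion_index e eps = #|V| <->
  exists eta : V -> R, absorbing e eps eta /\ injective eta.
Proof.
have [eta [eta_abs eta_max]] := opinion_index_attained e eps.
split=> [idx|[theta [theta_abs /num_opinions_card theta_card]]].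
  by exists eta; split=> //; apply/num_opinions_card; rewrite eta_max.
apply/eqP; rewrite eqn_leq -{1}eta_max num_opinions_le/= -theta_card.
exact: opinion_index_ub.
Qed.

(** Cutting the unit interval at [1/2] separates neighbours: two opinions on
    the same side are at distance at most [1/2]. *)
Lemma bipartite_of_inj_absorbing (R : realType) (V : finType) (e : rel V)
    (eps : R) (eta : V -> R) :
  irreflexive e -> 1 / 2 <= eps -> absorbing e eps eta -> injective eta ->
  bipartite e.
Proof.
move=> irr eps_ge [eta01 eta_abs] eta_inj.
exists [set x | eta x < 1 / 2] => x y exy; rewrite !inE.
have far : eps < `|eta x - eta y|.
  by case: (eta_abs x y exy) => // /eta_inj xy; rewrite xy irr in exy.
have /andP[x0 x1] := eta01 x; have /andP[y0 y1] := eta01 y.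
move: far; rewrite ltNge; apply: contraNneq.
case: (ltP (eta y)) => y2; case: (ltP (eta x)) => x2 // _;
  by rewrite ler_norml; apply/andP; split; lra.
Qed.

(** Any injective family of values in the open interval from [0] to
    [(1 - eps) / 2] gives the offsets from the two endpoints; here the offset
    of the vertex of rank [n] is [(1 - eps) / (n + 3)]. *)
Lemma inj_absorbing_of_bipartite (R : realType) (V : finType) (e : rel V)
    (eps : R) :
  0 <= eps < 1 -> bipartite e ->
  exists eta : V -> R, absorbing e eps eta /\ injective eta.
Proof.
move=> /andP[eps0 eps1] [A eA].
pose c (x : V) : R := (1 - eps) / (enum_rank x).+3%:R.
have c_gt0 x : 0 < c x by rewrite divr_gt0// subr_gt0.
have c_lt x : c x < (1 - eps) / 2.
  by rewrite ltr_pM2l ?subr_gt0// ltf_pV2 ?posrE// ltr_nat.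
have c_inj : injective c.
  have d_neq0 : 1 - eps != 0 by rewrite subr_eq0 gt_eqF.
  move=> x y /(mulfI d_neq0)/invr_inj/eqP; rewrite eqr_nat !eqSS => /eqP.
  by move/val_inj/enum_rank_inj.
exists (fun x => if x \in A then c x else 1 - c x); split; first split.
- move=> x; have := c_gt0 x; have := c_lt x.
  by case: ifP => _ *; apply/andP; split; lra.
- move=> x y exy; left; have := eA x y exy.
  have := c_lt x; have := c_lt y.
  case: (x \in A); case: (y \in A) => // ly lx _; last first.
    by rewrite ltr_normr; apply/orP; left; lra.
  by rewrite ltr_normr; apply/orP; right; lra.
- move=> x y; have := c_lt x; have := c_lt y.
  case: ifP => _; case: ifP => _ ly lx eq_xy; first exact: c_inj.
  - by exfalso; lra.
  - by exfalso; lra.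
  - by apply: c_inj; lra.
Qed.

Theorem corollary1p4 (R : realType) (V : finType) (e : rel V) (N : nat)
    (eps : R) (e_simple : simple_graph e) (e_connected : connected_graph e)
    (cardV : #|V| = N) (eps_gt : 1 / 2 < eps) (eps_lt : eps < 1) :
  opinion_index e eps = N <-> bipartite e.
Proof.
rewrite -cardV opinion_index_card; split=> [[eta [eta_abs eta_inj]]|].
  exact: bipartite_of_inj_absorbing e_simple.2 (ltW eps_gt) eta_abs eta_inj.
by apply: inj_absorbing_of_bipartite; apply/andP; split; lra.
Qed.
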